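(* Let $\mathcal F$ be a filtration sequence, $E=(E_{m,n})_{m,n\in\mathbb N}$ a nonnegative process adapted to $\mathcal F$, and $r=(r_m)_{m\in\mathbb N}$ an extended integer sequence. The following are equivalent: (i) $E$ is an $r$-asymptotic e-process for $\mathcal P$ and $\mathcal F$; (ii) for every $\tau=(\tau_m)_{m\in\mathbb N}\in\mathcal T_{\mathrm{fin}}(r,\mathcal F,\mathcal P)$, $\limsup_{m\to\infty}\sup_{P\in\mathcal P}\mathbb E_P[E_{m,\tau_m}]\le 1$; (iii) there exists a family $(L^P_{m,n})_{(m,n,P)\in\mathbb N\times\mathbb N\times\mathcal P}$ of nonnegative random variables, with $L^P_{m,\bullet}$ adapted to $\mathcal F_{m,\bullet}$, and some $m_0\in\mathbb N$ such that: (a) $L^P_{m,n}\ge E_{m,n}$ $P$-a.s. for all $m,n\in\mathbb N$ and $P\in\mathcal P$; (b) $L^P_{m,n}$ is $P$-integrable for all $m\ge m_0$, all $n\in\mathbb N$ with $n\le r_m$, and all $P\in\mathcal P$; (c) for all $m\ge m_0$, all $P\in\mathcal P$ and all $n\in\mathbb N$ with $n\le r_m-1$, $\mathbb E_P[L^P_{m,n+1}\mid\mathcal F_{m,n}]\le L^P_{m,n}$ $P$-a.s.; (d) $\limsup_{m\to\infty}\sup_{P\in\mathcal P}\mathbb E_P[L^P_{m,0}]\le 1$.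
   Context: $(\Omega,\mathcal A)$ is a measurable space and $\mathcal P$ a set of probability measures on it. $\mathbb N=\{0,1,\dots\}$; an extended integer is an element of $\mathbb N\cup\{\infty\}$ (with $\infty-1=\infty$). Nonnegative random variables take values in $[0,\infty]$ with $\mathbb E_P[X]:=\infty$ if not $P$-integrable. For a process $(X_n)$, $X_\infty:=\limsup_n X_n$ pointwise (so $E_{m,\tau}$ is defined when $\tau=\infty$). A filtration sequence is a family $(\mathcal F_{m,n})_{m,n\in\mathbb N}$ of sub-$\sigma$-algebras of $\mathcal A$ such that each $\mathcal F_{m,\bullet}$ is a filtration; adapted means $E_{m,n}$ is $\mathcal F_{m,n}$-measurable. For a filtration $\mathcal G$ and $\rho\in\mathbb N\cup\{\infty\}$, $\mathcal T(\rho,\mathcal G,\mathcal P)$ is the set of $\mathcal G$-stopping times $\tau$ (values in $\mathbb N\cup\{\infty\}$) with $P[\tau\le\rho]=1$ for all $P\in\mathcal P$, and $\mathcal T_{\mathrm{fin}}(\rho,\mathcal G,\mathcal P)$ its subset of stopping times finite at every $\omega$. $\mathcal T(r,\mathcal F,\mathcal P)$ (resp. $\mathcal T_{\mathrm{fin}}(r,\mathcal F,\mathcal P)$) is the set of sequences $(\tau_m)$ with $\tau_m\in\mathcal T(r_m,\mathcal F_{m,\bullet},\mathcal P)$ (resp. $\mathcal T_{\mathrm{fin}}(r_m,\mathcal F_{m,\bullet},\mathcal P)$). A nonnegative adapted process $E$ is an $r$-asymptotic e-process if for every $\tau\in\mathcal T(r,\mathcal F,\mathcal P)$, $\limsup_{m\to\infty}\sup_{P\in\mathcal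 P}\mathbb E_P[E_{m,\tau_m}]\le 1$. *)

(* Defs.v *)
From HB Require Import structures.
From mathcomp Require Import all_boot all_order all_algebra.
From mathcomp Require Import all_classical all_reals all_analysis.
From mathcomp Require Import measurable_realfun.
Set Implicit Arguments. Unset Strict Implicit. Unset Printing Implicit Defensive.
Import Order.TTheory GRing.Theory Num.Theory.
Local Open Scope classical_set_scope.
Local Open Scope ring_scope.
Local Open Scope ereal_scope.

Inductive xnat := Fin of nat | Inf.

Definition xle (a b : xnat) : Prop :=
  match a, b with
  | _, Inf => True
  | Inf, Fin _ => False
  | Fin x, Fin y => (x <= y)%N
  end.

Section defs.
Context {R : realType} {d : measure_display} {Omega : measurableType d}.

Definition sub_sigma (G : set (set Omega)) : Prop :=
  sigma_algebra setT G /\ (forall A, G A -> measurable A).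

Definition measurable_wrt (G : set (set Omega)) (f : Omega -> \bar R) : Prop :=
  forall B : set (\bar R), measurable B -> G (f @^-1` B).

Definition filtration (G : nat -> set (set Omega)) : Prop :=
  (forall n, sub_sigma (G n)) /\ (forall n A, G n A -> G n.+1 A).

Definition filtration_seq (F : nat -> nat -> set (set Omega)) : Prop :=
  forall m, filtration (F m).

Definition nonneg_process (X : nat -> nat -> Omega -> \bar R) : Prop :=
  forall m n w, 0 <= X m n w.

Definition adapted (F : nat -> nat -> set (set Omega))
  (X : nat -> nat -> Omega -> \bar R) : Prop :=
  forall m n, measurable_wrt (F m n) (X m n).

Definition stopping_time (G : nat -> set (set Omega)) (tau : Omega -> xnat) : Prop :=
  forall n, G n [set w | xle (tau w) (Fin n)].

Definition stop_T (rho : xnat) (G : nat -> set (set Omega))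
  (PP : set (probability Omega R)) (tau : Omega -> xnat) : Prop :=
  stopping_time G tau /\
  forall P, PP P -> P [set w | xle (tau w) rho] = 1%E.

Definition stop_Tfin (rho : xnat) (G : nat -> set (set Omega))
  (PP : set (probability Omega R)) (tau : Omega -> xnat) : Prop :=
  stop_T rho G PP tau /\ forall w, tau w <> Inf.

Definition stop_seq_T (r : nat -> xnat) (F : nat -> nat -> set (set Omega))
  (PP : set (probability Omega R)) (tau : nat -> Omega -> xnat) : Prop :=
  forall m, stop_T (r m) (F m) PP (tau m).

Definition stop_seq_Tfin (r : nat -> xnat) (F : nat -> nat -> set (set Omega))
  (PP : set (probability Omega R)) (tau : nat -> Omega -> xnat) : Prop :=
  forall m, stop_Tfin (r m) (F m) PP (tau m).

Definition stopped (X : nat -> Omega -> \bar R) (tau : Omega -> xnat) : Omega -> \bar R :=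
  fun w => match tau w with
           | Fin n => X n w
           | Inf => limn_esup (fun n => X n w)
           end.

(** E_P[X] for a nonnegative random variable (= +oo when not integrable). *)
Definition expect (P : probability Omega R) (X : Omega -> \bar R) : \bar R :=
  \int[P]_w X w.

Definition limsup_sup_expect (PP : set (probability Omega R))
  (X : nat -> probability Omega R -> Omega -> \bar R) : \bar R :=
  limn_esup (fun m => ereal_sup [set expect P (X m P) | P in PP]).

Definition asymptotic_eprocess (PP : set (probability Omega R))
  (F : nat -> nat -> set (set Omega)) (r : nat -> xnat)
  (E : nat -> nat -> Omega -> \bar R) : Prop :=
  nonneg_process E /\ adapted F E /\
  forall tau, stop_seq_T r F PP tau ->
    limsup_sup_expect PP (fun m _ => stopped (E m) (tau m)) <= 1.

Definition cond_exp_version (P : probability Omega R) (G : set (set Omega))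
  (X Z : Omega -> \bar R) : Prop :=
  [/\ measurable_wrt G Z, P.-integrable setT Z &
      forall A, G A -> \int[P]_(w in A) Z w = \int[P]_(w in A) X w].

Definition cond_exp_le (P : probability Omega R) (G : set (set Omega))
  (X Y : Omega -> \bar R) : Prop :=
  exists Z, cond_exp_version P G X Z /\ {ae P, forall w, Z w <= Y w}.

End defs.

(* Main.v *)
Require Import Defs.
From HB Require Import structures.
From mathcomp Require Import all_boot all_order all_algebra.
From mathcomp Require Import all_classical all_reals all_analysis.
From mathcomp Require Import measurable_realfun.
Import Order.TTheory GRing.Theory Num.Theory.
Local Open Scope classical_set_scope.
Local Open Scope ereal_scope.
Set Implicit Arguments.
Unset Strict Implicit.
Unset Printing Implicit Defensive.

(** (ii) => (iii): picking nearly optimal stopping times shows that the suprema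
    of E_P[E_{m,s}] over P and over the bounded stopping times s <= r_m have
    limsup at most 1, hence are finite for large m.  Then L^P_{m,.} is the Snell
    envelope of E_{m,.} frozen at time r_m, whose initial expectation is such a
    supremum.

    (iii) => (i): optional stopping bounds E_P[E_{m,s}] by E_P[L^P_{m,0}] for
    bounded s <= r_m.  Unbounded times reduce to bounded ones without martingale
    convergence.  Indeed E_{m,tau} is the limsup of the stopped process
    Y_n = E_{m, min(n, tau)}, and limsup Y is approximated from below by Y at
    bounded times: take the maximum of Y over a late window, then wait until Y
    almost reaches that value again.  Fatou's lemma concludes. *)

(** * Sub-σ-algebras, conditional expectations and almost sure comparison *)

Section sub_sigma_theory.
Context {R : realType} {d : measure_display} {Omega : measurableType d}.
Implicit Types (G : set (set Omega)) (f g : Omega -> \bar R).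

Lemma measurable_wrtP G f : sigma_algebra setT G ->
  measurable_wrt G f <-> measurable_fun [set: g_sigma_algebraType G] f.
Proof.
move=> sG; split => [Gf _ B mB|mf B mB].
  by rewrite setTI /measurable/= sigma_algebra_id//; exact: Gf.
by have := mf measurableT B mB; rewrite setTI /measurable/= sigma_algebra_id.
Qed.

Lemma sub_sigma_measurable_fun G f : sub_sigma G -> measurable_wrt G f ->
  measurable_fun setT f.
Proof. by move=> [_ Gm] Gf _ B mB; rewrite setTI; exact/Gm/Gf. Qed.

Lemma sub_sigma0 G : sub_sigma G -> G set0.
Proof. by move=> [[]]. Qed.

Lemma sub_sigmaT G : sub_sigma G -> G setT.
Proof. by move=> [[G0 GC _] _]; rewrite -(setD0 setT); exact: GC. Qed.

Lemma sub_sigmaC G A : sub_sigma G -> G A -> G (~` A).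
Proof. by move=> [[_ GC _] _] GA; rewrite -setTD; exact: GC. Qed.

Lemma sub_sigmaI G A B : sub_sigma G -> G A -> G B -> G (A `&` B).
Proof.
move=> [sG _] GA GB.
have <- : measurable (A `&` B : set (g_sigma_algebraType G)) = G (A `&` B).
  by rewrite /measurable/= sigma_algebra_id.
by apply: measurableI; rewrite /measurable/= sigma_algebra_id.
Qed.

Lemma sub_sigmaU G A B : sub_sigma G -> G A -> G B -> G (A `|` B).
Proof.
move=> sG GA GB; rewrite -(setCK (A `|` B)) setCU.
by apply: (sub_sigmaC sG); apply: sub_sigmaI => //; exact: sub_sigmaC.
Qed.

Lemma measurable_wrt_lt G f g : sub_sigma G ->
  measurable_wrt G f -> measurable_wrt G g -> G [set w | f w < g w].
Proof.
move=> [sG _] /(measurable_wrtP _ sG) mf /(measurable_wrtP _ sG) mg.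
have := measurable_lte measurableT mf mg.
by rewrite setTI /measurable/= sigma_algebra_id.
Qed.

(** Radon-Nikodym on the space equipped with [G] alone: the measure [A |-> \int[P]_(w in A) f w] is
    dominated by the restriction of [P] to [G], and its density is [G]-measurable by
    construction. *)
Lemma ex_cond_exp (P : probability Omega R) G f : sub_sigma G ->
  P.-integrable setT f -> (forall w, 0 <= f w) ->
  exists g, [/\ forall w, 0 <= g w, measurable_wrt G g, P.-integrable setT g &
    forall A, G A -> \int[P]_(w in A) g w = \int[P]_(w in A) f w].
Proof.
move=> sG intf f0; have [sGG Gm] := sG.
(* The identity, read as a map into the coarser measurable space; its distribution [Q] is [P]
   restricted to [G]. *)
pose i : Omega -> g_sigma_algebraType G := id.
have mG (A : set (g_sigma_algebraType G)) : measurable A <-> G A.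
  by rewrite /measurable/= sigma_algebra_id.
have mi : measurable_fun setT i.
  by move=> _ A /mG GA; rewrite setTI; exact: Gm.
pose I : {mfun Omega >-> g_sigma_algebraType G} :=
  HB.pack i (isMeasurableFun.Build _ _ _ _ i mi).
pose Q : probability (g_sigma_algebraType G) R := distribution P I.
pose nu0 : set (g_sigma_algebraType G) -> \bar R :=
  fun A => \int[P]_(w in A) f w.
have nu00 : nu0 set0 = 0 by rewrite /nu0 integral_set0.
have nuge0 A : 0 <= nu0 A by exact: integral_ge0.
have nuadd : semi_sigma_additive nu0.
  move=> A mA tA mUA.
  have := semi_sigma_additive_nng_induced (measurable_int _ intf) f0.
  apply => //; last exact/Gm/mG.
  by move=> n; exact/Gm/mG.
have nufin : fin_num_fun nu0.
  move=> A /mG/Gm mA; apply: integrable_fin_num => //.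
  exact: integrableS intf.
pose M := isMeasure.Build _ _ _ nu0 nu00 nuge0 nuadd.
pose nu1 : {measure set (g_sigma_algebraType G) -> \bar R}%R := HB.pack nu0 M.
pose nu : {finite_measure set (g_sigma_algebraType G) -> \bar R}%R :=
  HB.pack nu0 M (Measure_isFinite.Build _ _ _ nu1 nufin).
have nuQ : nu `<< Q.
  apply/null_content_dominatesP => A /mG/Gm mA QA.
  apply: null_set_integral => //.
  exact/(measurable_funS measurableT)/(measurable_int _ intf).
have [g [g0 intg gE]] := radon_nikodym_finite nuQ.
have mg := measurable_int _ intg.
have gPE A : G A -> \int[P]_(w in A) g w = \int[P]_(w in A) f w.
  move=> GA; have mA := (mG A).2 GA.
  rewrite -[RHS]/(nu A) gE// (ge0_integral_pushforward mi)//.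
  exact: measurable_funTS.
have Gg : measurable_wrt G g by apply/measurable_wrtP.
exists g; split => //; apply/integrableP; split.
  exact: sub_sigma_measurable_fun Gg.
under eq_integral do rewrite gee0_abs//.
rewrite gPE; last exact: sub_sigmaT.
exact: integrable_lty.
Qed.

Lemma integrable_ge0P (P : probability Omega R) f : measurable_fun setT f ->
  (forall w, 0 <= f w) -> P.-integrable setT f <-> \int[P]_w f w < +oo.
Proof.
move=> mf f0; split=> [/integrableP[_]|foo];
  last (apply/integrableP; split=> //);
  by under eq_integral do rewrite gee0_abs//.
Qed.

(** Tested on the event [g < f], which lies in [G], the hypothesis forces the nonnegative difference
    [f - g] to have integral zero there, so this event is null. *)
Lemma ae_le_of_integral_le (P : probability Omega R) G f g : sub_sigma G ->
  measurable_wrt G f -> measurable_wrt G g ->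
  P.-integrable setT f -> P.-integrable setT g ->
  (forall A, G A -> \int[P]_(w in A) f w <= \int[P]_(w in A) g w) ->
  {ae P, forall w, f w <= g w}.
Proof.
move=> sG Gf Gg intf intg fg.
pose A := [set w | g w < f w].
have GA : G A by exact: measurable_wrt_lt.
have mA : measurable A by exact: sG.2.
have intAf : P.-integrable A f by exact: integrableS intf.
have intAg : P.-integrable A g by exact: integrableS intg.
have int0 : \int[P]_(w in A) `|(f w - g w)| = 0.
  apply/eqP; rewrite eq_le integral_ge0// andbT.
  have -> : \int[P]_(w in A) `|(f w - g w)| = \int[P]_(w in A) (f w - g w).
    apply: eq_integral => w; rewrite inE => Aw.
    by rewrite gee0_abs// ltW// sube_gt0.
  rewrite integralB// leeBlDr ?add0e ?fg//; exact: integrable_fin_num.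
have mfg : measurable_fun A (fun w => f w - g w).
  by apply: emeasurable_funB; apply: measurable_int; eassumption.
have := ae_eq_integral_abs P mA mfg; move=> [/(_ int0) + _].
apply: filterS => w /= Aw; rewrite leNgt; apply/negP => gf.
by have := Aw gf; move: gf; rewrite -sube_gt0 => /[swap] ->; rewrite ltxx.
Qed.

(** Here [f] may change sign and [g] may have infinite integral. Since [g] is nonnegative it also
    dominates the positive part of [f], which reduces the claim to nonnegative functions. *)
Lemma ae_le_integral (P : probability Omega R) A f g : measurable A ->
  P.-integrable A f -> measurable_fun A g -> (forall w, 0 <= g w) ->
  {ae P, forall w, f w <= g w} ->
  \int[P]_(w in A) f w <= \int[P]_(w in A) g w.
Proof.
move=> mA intf mg g0 fg; have mf := measurable_int _ intf.
rewrite integralE; apply: (@le_trans _ _ (\int[P]_(w in A) f^\+ w)).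
  by rewrite leeBlDr ?leeDl ?integral_ge0//;
    apply: integrable_fin_num => //; exact: integrable_funeneg.
apply: ae_ge0_le_integral => //; first exact: measurable_funepos.
by apply: filterS fg => w fgw _; rewrite funeposE ge_max fgw g0.
Qed.

End sub_sigma_theory.

(** * Bounded stopping times of a filtration *)

Section stopping.
Context {R : realType} {d : measure_display} {Omega : measurableType d}.
Variable G : nat -> set (set Omega).
Hypothesis fG : filtration G.
Implicit Types (s t : Omega -> nat) (tau : Omega -> xnat)
  (X : nat -> Omega -> \bar R).

Let sG n : sub_sigma (G n) := fG.1 n.

Lemma filtration_le i j A : (i <= j)%N -> G i A -> G j A.
Proof.
move=> /subnK <-; elim: (j - i)%N => // k ih /ih; rewrite addSn; exact: fG.2.
Qed.

(** The lower bound [n] is what allows two such times to be pasted along an event of [G n]. *)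
Definition bounded_stopping (n N : nat) s : Prop :=
  (forall w, n <= s w <= N)%N /\ forall j, G j [set w | (s w <= j)%N].

Lemma sub_sigma_prop (H : set (set Omega)) (p : Prop) :
  sub_sigma H -> H [set _ | p].
Proof.
move=> sH; have [pT|pF] := pselect p.
  by rewrite (_ : [set _ : Omega | p] = setT);
    [exact: sub_sigmaT|apply/seteqP; split].
by rewrite (_ : [set _ : Omega | p] = set0);
  [exact: sub_sigma0|apply/seteqP; split].
Qed.

Lemma bounded_stopping_cst n : bounded_stopping n n (fun=> n).
Proof. by split=> [w|j]; [rewrite leqnn|exact: sub_sigma_prop]. Qed.

Lemma bounded_stopping_le n n' N N' s : (n' <= n)%N -> (N <= N')%N ->
  bounded_stopping n N s -> bounded_stopping n' N' s.
Proof.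
move=> n'n NN' [sN Gs]; split => // w; have /andP[ns sN1] := sN w.
by rewrite (leq_trans n'n ns) (leq_trans sN1 NN').
Qed.

Lemma bounded_stopping_if n N A s t : G n A ->
  bounded_stopping n N s -> bounded_stopping n N t ->
  bounded_stopping n N (fun w => if w \in A then s w else t w).
Proof.
move=> GA [sN Gs] [tN Gt]; split=> [w|j]; first by case: ifP.
(* From time [n] on, [A] is known; before [n], neither time has occurred and the event is empty. *)
have [nj|jn] := leqP n j.
  rewrite (_ : [set _ | _] = (A `&` [set w | (s w <= j)%N]) `|`
    (~` A `&` [set w | (t w <= j)%N])).
    have GjA := filtration_le nj GA.
    apply: (sub_sigmaU (sG j)); apply: (sub_sigmaI (sG j)) => //.
    exact: (sub_sigmaC (sG j)).
  apply/seteqP; split=> w /=; 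
    first by case: ifPn => [/set_mem|/negP]; rewrite ?inE; tauto.
  by case=> -[Aw]; [rewrite mem_set|rewrite memNset].
rewrite (_ : [set _ | _] = set0); first exact: sub_sigma0.
apply/seteqP; split=> // w /=; case: ifP => _; apply/negP; rewrite -ltnNge;
  apply: (leq_trans jn).
  by have /andP[] := sN w.
by have /andP[] := tN w.
Qed.

Definition cap (n : nat) (x : xnat) : nat := if x is Fin k then minn n k else n.

Lemma cap_le n x : (cap n x <= n)%N.
Proof. by case: x => [k|] /=; rewrite ?geq_minl. Qed.

Lemma xle_cap n x : xle (Fin (cap n x)) x.
Proof. by case: x => [k|] //=; rewrite geq_minr. Qed.

Lemma bounded_stopping_cap N s tau : bounded_stopping 0 N s ->
  stopping_time G tau -> bounded_stopping 0 N (fun w => cap (s w) (tau w)).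
Proof.
move=> [sN Gs] Gtau; split=> [w|j].
  by have /andP[_] := sN w; apply: leq_trans; exact: cap_le.
rewrite (_ : [set _ | _] = [set w | (s w <= j)%N] `|`
  [set w | xle (tau w) (Fin j)]); first exact: sub_sigmaU.
apply/seteqP; split=> w /=; case: (tau w) => [k|] /=; rewrite ?geq_min.
- by case/orP; [left|right].
- by left.
- by case=> ->; rewrite ?orbT.
- by case.
Qed.

Lemma stopping_time_cst x : stopping_time G (fun=> x).
Proof. by move=> n; exact: sub_sigma_prop. Qed.

Lemma measurable_wrt_stopped X n N s : (forall k, measurable_wrt (G k) (X k)) ->
  bounded_stopping n N s -> measurable_wrt (G N) (fun w => X (s w) w).
Proof.
move=> GX [sN Gs] B mB; rewrite (_ : _ @^-1` _ = \bigcup_k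
    ([set w | s w = k] `&` X k @^-1` B)); last first.
  by apply/seteqP; split=> [w Bw|w [k _ [/= <-]]//]; exists (s w).
have [[G0 _ GU] _] := sG N; apply: GU => k.
have [kN|Nk] := leqP k N; last first.
  rewrite (_ : _ `&` _ = set0)//; apply/seteqP; split=> // w [/= swk _].
  by have /andP[_] := sN w; rewrite swk leqNgt Nk.
apply: (filtration_le kN); apply: (sub_sigmaI (sG k)); last exact: GX.
rewrite (_ : [set _ | _] =
  [set w | (s w <= k)%N] `&` ~` [set w | (s w < k)%N]).
  apply: (sub_sigmaI (sG k)) => //; apply: (sub_sigmaC (sG k)).
  case: k kN => [|k] kN.
    rewrite (_ : [set _ | _] = set0); first exact: sub_sigma0.
    by apply/seteqP; split.
  exact/(filtration_le (leqnSn k))/Gs.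
apply/seteqP; split=> w /=; first by move=> ->; rewrite ltnn leqnn.
by move=> [sk /negP]; rewrite -leqNgt => ks; apply/eqP; rewrite eqn_leq sk.
Qed.

Lemma measurable_stopped X n N s : (forall k, measurable_wrt (G k) (X k)) ->
  bounded_stopping n N s -> measurable_fun setT (fun w => X (s w) w).
Proof.
by move=> GX bs; apply: (sub_sigma_measurable_fun (sG N));
  exact: measurable_wrt_stopped bs.
Qed.

End stopping.

(** * The Snell envelope under a fixed probability *)

Section snell.
Context {R : realType} {d : measure_display} {Omega : measurableType d}.
Variables (P : probability Omega R) (G : nat -> set (set Omega)).
Hypothesis fG : filtration G.
Variable X : nat -> Omega -> \bar R.
Hypothesis X0 : forall n w, 0 <= X n w.
Hypothesis GX : forall n, measurable_wrt (G n) (X n).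
Variable c : \bar R.
Hypothesis c_lty : c < +oo.
Hypothesis Xc : forall n N s, bounded_stopping G n N s ->
  \int[P]_w X (s w) w <= c.

Let sG n : sub_sigma (G n) := fG.1 n.

(** A chosen version of the conditional expectation, nonnegative everywhere; by [cexpP] the default
    [cst 0] is harmless for integrable nonnegative [f]. *)
Definition cexp (H : set (set Omega)) (f : Omega -> \bar R) : Omega -> \bar R :=
  xget (cst 0) [set g | [/\ forall w, 0 <= g w, measurable_wrt H g,
    P.-integrable setT g &
    forall A, H A -> \int[P]_(w in A) g w = \int[P]_(w in A) f w]].

Lemma cexpP H f : sub_sigma H -> P.-integrable setT f -> (forall w, 0 <= f w) ->
  [/\ forall w, 0 <= cexp H f w, measurable_wrt H (cexp H f),
    P.-integrable setT (cexp H f) &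
    forall A, H A -> \int[P]_(w in A) cexp H f w = \int[P]_(w in A) f w].
Proof.
move=> sH intf f0; have [g Hg] := ex_cond_exp sH intf f0.
by rewrite /cexp; case: xgetP => [h _|/(_ g)].
Qed.

(* The value at time [n] with at most [k] steps left.  The maximum is taken with
   the previous iterate rather than with [X n], so that the iterates increase
   with [k] everywhere and not only almost surely. *)
Fixpoint snell (k n : nat) : Omega -> \bar R :=
  if k is k'.+1 then fun w => maxe (snell k' n w) (cexp (G n) (snell k' n.+1) w)
  else X n.

(** Each iterate is a conditional expectation of [X] at an explicit bounded stopping time. The bound
    [c] then makes the iterate integrable, which is what the next conditional expectation
    requires. *)
Lemma snellP k n : [/\ forall w, 0 <= snell k n w,
  measurable_wrt (G n) (snell k n),
  P.-integrable setT (snell k n) &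
  exists N s, bounded_stopping G n N s /\ forall A, G n A ->
    \int[P]_(w in A) snell k n w = \int[P]_(w in A) X (s w) w].
Proof.
suff [f0 Gf [N [s [bs fE]]]] : [/\ forall w, 0 <= snell k n w,
  measurable_wrt (G n) (snell k n) &
  exists N s, bounded_stopping G n N s /\ forall A, G n A ->
    \int[P]_(w in A) snell k n w = \int[P]_(w in A) X (s w) w].
  split=> //; last by exists N, s.
  apply/integrable_ge0P => //; first exact: sub_sigma_measurable_fun Gf.
  rewrite fE; last exact: sub_sigmaT.
  exact: le_lt_trans (Xc bs) c_lty.
elim: k n => [|k ih] n.
  split=> //; exists n, (fun=> n); split => //; exact: bounded_stopping_cst.
have [f0 Gf [N [s [bs fE]]]] := ih n.
have [g0 Gg [M [t [bt gE]]]] := ih n.+1.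
have intg : P.-integrable setT (snell k n.+1).
  apply/integrable_ge0P => //; first exact: sub_sigma_measurable_fun Gg.
  rewrite gE; last exact: sub_sigmaT.
  exact: le_lt_trans (Xc bt) c_lty.
have [h0 Gh inth hE] := cexpP (sG n) intg g0.
(* On [B] continuing beats stopping: the new time follows [t], which starts at [n.+1], on [B], and
   [s] elsewhere. *)
pose B := [set w | snell k n w < cexp (G n) (snell k n.+1) w].
have GB : G n B by exact: measurable_wrt_lt.
split.
- by move=> w /=; rewrite le_max f0.
- have sGn := (sG n).1; apply/measurable_wrtP => //=.
  by apply: measurable_maxe; apply/measurable_wrtP.
pose u w := if w \in B then t w else s w.
have bu : bounded_stopping G n (maxn N M) u.
  apply: bounded_stopping_if => //.
    by apply: bounded_stopping_le bt => //; rewrite leq_maxr.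
  by apply: bounded_stopping_le bs => //; rewrite leq_maxl.
exists (maxn N M), u; split=> //.
have mt := measurable_stopped fG GX bt.
have ms := measurable_stopped fG GX bs.
have mu := measurable_stopped fG GX bu.
have msup : measurable_fun setT (snell k.+1 n).
  have mf := sub_sigma_measurable_fun (sG n) Gf.
  have mh := sub_sigma_measurable_fun (sG n) Gh.
  exact: measurable_maxe.
move=> A GA.
have GAB : G n (A `&` B) by exact: sub_sigmaI.
have GAB' : G n (A `\` B).
  by rewrite setDE; apply: sub_sigmaI => //; exact: sub_sigmaC.
have mAB : measurable (A `&` B) by exact: (sG n).2.
have mAB' : measurable (A `\` B) by exact: (sG n).2.
have split f : measurable_fun setT f -> (forall w, 0 <= f w) ->
    \int[P]_(w in A) f w =
    \int[P]_(w in A `&` B) f w + \int[P]_(w in A `\` B) f w.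
  move=> mf f0'; rewrite -{1}(setUIDK A B) ge0_integral_setU//.
    exact: measurable_funTS.
  by rewrite disj_set2E; apply/eqP/seteqP; split=> // w [[_ Bw] [_ /(_ Bw)]].
rewrite split//; last by move=> w /=; rewrite le_max f0.
rewrite [RHS]split//; congr (_ + _).
  rewrite (eq_integral (cexp (G n) (snell k n.+1))); last first.
    by move=> w; rewrite inE => -[_ Bw] /=; apply/max_idPr/ltW.
  rewrite hE// gE; last exact: fG.2.
  by apply: eq_integral => w; rewrite inE => -[_ Bw]; rewrite /u mem_set.
rewrite (eq_integral (snell k n)); last first.
  move=> w; rewrite inE => -[_ /negP]; rewrite -leNgt => Bw /=.
  exact/max_idPl.
rewrite fE//; apply: eq_integral => w; rewrite inE => -[_ Bw].
by rewrite /u memNset.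
Qed.

Lemma snell_nd n w : nondecreasing_seq (fun k => snell k n w).
Proof. by apply/nondecreasing_seqP => k /=; rewrite le_max lexx. Qed.

(** A monotone limit of countably many iterates stands in for the essential supremum over stopping
    times. *)
Definition snell_sup n w := limn (fun k => snell k n w).

Lemma snell_cvg n w : snell k n w @[k --> \oo] --> snell_sup n w.
Proof. exact/ereal_nondecreasing_is_cvgn/snell_nd. Qed.

Lemma snell_le_sup k n w : snell k n w <= snell_sup n w.
Proof.
rewrite /snell_sup; apply: lime_ge; first exact: snell_cvg.
by exists k => // j /= kj; exact: snell_nd.
Qed.

Lemma integral_snell_sup_le n A b : measurable A ->
  (forall k, \int[P]_(w in A) snell k n w <= b) ->
  \int[P]_(w in A) snell_sup n w <= b.
Proof.
move=> mA kb; have ms k : measurable_fun A (snell k n).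
  have [_ Gs _ _] := snellP k n.
  exact/measurable_funTS/(sub_sigma_measurable_fun (sG n)).
have s0 k w : A w -> 0 <= snell k n w by have [? _ _ _] := snellP k n.
have nd w : A w -> nondecreasing_seq (fun k => snell k n w).
  by move=> _; exact: snell_nd.
have cvgI : \int[P]_(w in A) snell k n w @[k --> \oo] -->
    \int[P]_(w in A) snell_sup n w by exact: cvg_monotone_convergence.
rewrite -(cvg_lim _ cvgI)//; apply: lime_le.
  by apply/cvg_ex; eexists; exact: cvgI.
exact: nearW.
Qed.

Lemma snell_sup_adapted n : measurable_wrt (G n) (snell_sup n).
Proof.
have sGn := (sG n).1; apply/measurable_wrtP => //.
apply: (@emeasurable_fun_cvg _ (g_sigma_algebraType (G n)) R setT (snell^~ n));
  last by move=> w _; exact: snell_cvg.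
by move=> k; have [_ Gs _ _] := snellP k n; apply/measurable_wrtP.
Qed.

Lemma snell_sup_ge0 n w : 0 <= snell_sup n w.
Proof.
by apply: le_trans (snell_le_sup 0 n w); have [+ _ _ _] := snellP 0 n; exact.
Qed.

Lemma integral_snell_sup n : \int[P]_w snell_sup n w <= c.
Proof.
apply: integral_snell_sup_le => // k.
have [_ _ _ [N [s [bs ->]]]] := snellP k n; last exact: sub_sigmaT.
exact: Xc bs.
Qed.

Lemma integrable_snell_sup n : P.-integrable setT (snell_sup n).
Proof.
apply/integrable_ge0P.
  exact/(sub_sigma_measurable_fun (sG n))/snell_sup_adapted.
  exact: snell_sup_ge0.
exact: le_lt_trans (integral_snell_sup n) c_lty.
Qed.

(** By monotone convergence it suffices to compare the iterates [snell k n.+1], and the conditional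
    expectation of each is one of the two terms in the maximum defining [snell k.+1 n]. *)
Lemma cond_exp_snell_sup n : cond_exp_le P (G n) (snell_sup n.+1) (snell_sup n).
Proof.
have [z0 Gz intz zE] :=
  cexpP (sG n) (integrable_snell_sup n.+1) (snell_sup_ge0 n.+1).
exists (cexp (G n) (snell_sup n.+1)); split; first by split.
have Gs := snell_sup_adapted n.
apply: (ae_le_of_integral_le (sG n)) => //; first exact: integrable_snell_sup.
move=> A GA; rewrite zE//; have mA := (sG n).2 _ GA.
apply: integral_snell_sup_le => // k.
have [f0 Gf intf _] := snellP k n.+1.
have [h0 Gh inth hE] := cexpP (sG n) intf f0.
rewrite -hE//; apply: ge0_le_integral => //.
- exact/measurable_funTS/(sub_sigma_measurable_fun (sG n)).
- exact/measurable_funTS/(sub_sigma_measurable_fun (sG n)).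
- move=> w _; apply: le_trans (snell_le_sup k.+1 n w).
  by rewrite /= le_max lexx orbT.
Qed.

Lemma ex_snell_envelope : exists L : nat -> Omega -> \bar R,
  [/\ forall n w, X n w <= L n w, forall n, measurable_wrt (G n) (L n),
    forall n, P.-integrable setT (L n),
    forall n, cond_exp_le P (G n) (L n.+1) (L n) & \int[P]_w L 0%N w <= c].
Proof.
exists snell_sup; split.
- by move=> n w; exact: (snell_le_sup 0).
- exact: snell_sup_adapted.
- exact: integrable_snell_sup.
- exact: cond_exp_snell_sup.
- exact: integral_snell_sup.
Qed.

End snell.

(** * Limits superior and inferior in the extended reals *)

Section limn_esup_extra.
Context {R : realType}.
Implicit Types (u v : nat -> \bar R) (a b : \bar R).

Lemma ereal_dense a b : a < b -> exists r : R, a < r%:E /\ r%:E < b.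
Proof.
case: a b => [a| |] [b| |]//.
- by rewrite lte_fin => ab; exists ((a + b) / 2)%R; rewrite !lte_fin !midf_lt.
- by move=> _; exists (a + 1)%R; rewrite lte_fin ltrDl ltr01 ltry.
- by move=> _; exists (b - 1)%R; rewrite lte_fin gtrBl ltr01 ltNyr.
- by move=> _; exists 0%R; rewrite ltNyr ltry.
Qed.

Lemma limn_esup_le u b : (exists k, forall n, (k <= n)%N -> u n <= b) ->
  limn_esup u <= b.
Proof.
move=> [k ub]; apply: (@le_trans _ _ (ereal_sup (u @` [set n | (k <= n)%N]))).
  by apply: ereal_inf_lbound; exists [set n | (k <= n)%N] => //; exists k.
by apply/ereal_supP => _ [n /= kn <-]; exact: ub.
Qed.

Lemma limn_esup_lt u b : limn_esup u < b ->
  exists k, forall n, (k <= n)%N -> u n < b.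
Proof.
move=> /ereal_inf_lt[_ [V [k _ kV] <-]] ub; exists k => n kn.
by apply: le_lt_trans ub; apply: ereal_sup_ubound; exists n => //; exact: kV.
Qed.

Lemma lt_limn_esup u b : b < limn_esup u ->
  forall k, exists2 n, (k <= n)%N & b < u n.
Proof.
move=> bu k; apply: contrapT => h; move: bu; apply/negP; rewrite -leNgt.
apply: limn_esup_le; exists k => n kn; rewrite leNgt; apply/negP => bun.
by apply: h; exists n.
Qed.

Lemma limn_esup_le_near u v : (exists k, forall n, (k <= n)%N -> u n <= v n) ->
  limn_esup u <= limn_esup v.
Proof.
move=> [k uv]; rewrite leNgt; apply/negP => /ereal_dense[a [va au]].
have [i iv] := limn_esup_lt va.
have [n] := lt_limn_esup au (maxn k i); rewrite geq_max => /andP[kn /iv vn] an.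
by have := lt_le_trans an (uv _ kn); rewrite ltNge ltW.
Qed.

Lemma le_limn_einf u a : (exists k, forall n, (k <= n)%N -> a <= u n) ->
  a <= limn_einf u.
Proof.
move=> [k au]; rewrite /limn_einf leeNr; apply: limn_esup_le; exists k => n kn.
by rewrite leeN2 au.
Qed.

End limn_esup_extra.

(** * Approximating a limit superior by values at bounded times *)

Section first_hit.
Context {R : realType} {d : measure_display} {Omega : measurableType d}.
Variable G : nat -> set (set Omega).
Hypothesis fG : filtration G.
Variable Y : nat -> Omega -> \bar R.
Hypothesis GY : forall n, measurable_wrt (G n) (Y n).

Let sG n : sub_sigma (G n) := fG.1 n.

(** The first time from [M] on at which [Y] reaches [theta], or [M + N] if none comes earlier. The
    recursion on the remaining steps lets the stopping property follow by repeated pasting. *)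
Fixpoint hit (theta : Omega -> \bar R) (N M : nat) (w : Omega) : nat :=
  if N is N'.+1 then
    if w \in [set w | Y M w < theta w] then hit theta N' M.+1 w else M
  else M.

Lemma bounded_stopping_hit theta N M : measurable_wrt (G M) theta ->
  bounded_stopping G M (M + N) (hit theta N M).
Proof.
elim: N M => [|N ih] M Gt.
  by rewrite addn0; exact: bounded_stopping_cst.
apply: bounded_stopping_if => //.
- exact: measurable_wrt_lt.
- rewrite addnS -addSn; apply: bounded_stopping_le (ih _ _) => //.
  by move=> B mB; apply: fG.2; exact: Gt.
- by apply: bounded_stopping_le (bounded_stopping_cst fG M); rewrite // leq_addr.
Qed.

Lemma le_hit theta N M i w : (i < N)%N -> theta w <= Y (M + i) w ->
  theta w <= Y (hit theta N M w) w.
Proof.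
elim: N M i => // N ih M i iN ti /=.
case: ifPn => [/set_mem/= Yt|/negP];
  last by rewrite inE/= => /negP; rewrite -leNgt.
case: i iN ti => [_|i iN]; first by rewrite addn0 leNgt Yt.
by rewrite addnS -addSn; exact: ih.
Qed.

Fixpoint runmax (k l : nat) (w : Omega) : \bar R :=
  if l is l'.+1 then maxe (runmax k l' w) (Y (k + l) w) else Y k w.

Lemma measurable_wrt_runmax k l : measurable_wrt (G (k + l)) (runmax k l).
Proof.
elim: l => [|l ih]; first by rewrite addn0.
have sGn := (sG (k + l.+1)).1; apply/measurable_wrtP => //=.
apply: measurable_maxe; apply/measurable_wrtP => //.
by rewrite addnS => B mB; apply: fG.2; exact: ih.
Qed.

Lemma runmax_le k l w b : (forall n, (k <= n)%N -> Y n w <= b) ->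
  runmax k l w <= b.
Proof.
move=> Yb; elim: l => [|l ih] /=; first exact: Yb.
by rewrite ge_max ih Yb// leq_addr.
Qed.

Lemma le_runmax k l i w : (i <= l)%N -> Y (k + i) w <= runmax k l w.
Proof.
elim: l => [|l ih] /=; first by rewrite leqn0 => /eqP ->; rewrite addn0.
rewrite leq_eqVlt ltnS le_max => /orP[/eqP ->|/ih ->//].
by rewrite lexx orbT.
Qed.

(* [Y] need not return to the window maximum itself, even when that maximum is
   close to [limsup Y]; hence the truncation at [j] and the slack
   [1 / (j + 1)]. *)
Definition level (j k l : nat) (w : Omega) : \bar R :=
  mine (runmax k l w) j%:R%:E - (j.+1%:R^-1)%:E.

Lemma measurable_wrt_level j k l : measurable_wrt (G (k + l)) (level j k l).
Proof.
have sGn := (sG (k + l)).1; apply/measurable_wrtP => //.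
apply: emeasurable_funB => //; apply: measurable_mine => //.
apply/measurable_wrtP => //; exact: measurable_wrt_runmax.
Qed.

(** The order of the limits matters: the waiting time [N] goes to infinity first, then the window
    length [l], the window start [k], and last the precision [j]. For reals [a < b < X], the
    innermost value is eventually at least [a] in each limit. *)
Lemma limn_esup_le_hit w : (forall n, 0 <= Y n w) ->
  limn_esup (Y^~ w) <=
  limn_einf (fun j => limn_einf (fun k => limn_einf (fun l => limn_einf (fun N =>
    Y (hit (level j k l) N (k + l) w) w)))).
Proof.
move=> Y0; set X := limn_esup _.
rewrite leNgt; apply/negP => /ereal_dense[a [Za aX]]; move: Za; apply/negP.
rewrite -leNgt.
have [b [ab bX]] := ereal_dense aX; rewrite lte_fin in ab.
have ba0 : (0 < b - a)%R by rewrite subr_gt0.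
pose e (j : nat) : R := (j.+1%:R^-1)%R.
have e0 j : (0 < e j)%R by rewrite invr_gt0.
apply: le_limn_einf.
(* The first bound puts the truncation above [b], the second puts the slack below [b - a]; so the
   level is at least [a] once the window maximum is at least [b]. *)
exists (maxn (Num.bound `|b|%R) (Num.bound (b - a)^-1)) => j.
rewrite geq_max => /andP[bj baj].
have {bj} bj : (b <= j%:R)%R.
  rewrite (le_trans (ler_norm b))// ltW// (lt_le_trans (archi_boundP _))//.
  by rewrite ler_nat.
have {baj} ej : (e j <= b - a)%R.
  rewrite -[leRHS]invrK lef_pV2 ?posrE ?invr_gt0//.
  have /archi_boundP/ltW : (0 <= (b - a)^-1)%R by rewrite invr_ge0 ltW.
  by move=> /le_trans; apply; rewrite ler_nat (leq_trans baj).
(* An eventual upper bound [v] of [Y] that, truncated and lowered by the slack, falls below [X]: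
   [+oo] if [X] is infinite, and otherwise a real between [X] and [X + e j]. *)
have [v [k0 k0v] vX] : exists2 v : \bar R,
    (exists k0, forall n, (k0 <= n)%N -> Y n w <= v) &
    mine v j%:R%:E - (e j)%:E < X.
  have [Xoo|] := eqVneq X +oo.
    exists +oo; first by exists 0%N => n _; rewrite leey.
    by rewrite Xoo min_r ?leey// -EFinB ltry.
  rewrite -ltey => Xoo; have XX : X < X + (e j)%:E.
    rewrite lteDl// ?lte_fin// fin_numE -ltey Xoo andbT.
    by rewrite gt_eqF// (lt_trans _ aX)// ltNyr.
  have [v [Xv vX]] := ereal_dense XX.
  exists v%:E.
    have [k kv] := limn_esup_lt Xv; exists k => n kn; exact/ltW/kv.
  rewrite lteBlDr//; apply: le_lt_trans vX.
  by rewrite ge_min lexx.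
apply: le_limn_einf; exists k0 => k k0k.
(* A window long enough to contain [i] has maximum above [b]. *)
have [i ki bi] := lt_limn_esup bX k.
apply: le_limn_einf; exists (i - k)%N => l il.
(* After the window, [Y] still exceeds the lowered bound, hence the level, at some time [n]; waiting
   past [n] suffices. *)
have [n kln vn] := lt_limn_esup vX (k + l).
apply: le_limn_einf; exists (n - (k + l)).+1 => N nN.
apply: (@le_trans _ _ (level j k l w)).
  have bM : b%:E <= runmax k l w.
    by rewrite (le_trans (ltW bi))// -(subnKC ki); exact: le_runmax.
  rewrite /level -/(e j) leeBrDr// (@le_trans _ _ b%:E)//.
    by rewrite -EFinD lee_fin -lerBrDl.
  by rewrite le_min bM lee_fin.
apply: (@le_hit _ _ _ (n - (k + l))) => //; rewrite subnKC//.
apply: le_trans (ltW vn).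
rewrite /level -/(e j) leeB// le_min !ge_min lexx orbT andbT.
rewrite runmax_le// => m km; apply: k0v; exact: leq_trans km.
Qed.

End first_hit.

(** * Fatou's lemma applied to the limit superior *)

Section fatou_limsup.
Context {R : realType} {d : measure_display} {Omega : measurableType d}.
Variables (P : probability Omega R) (c : \bar R).

(** The bundle is stable under a limit inferior of sequences, so nested limits are handled by
    iteration. *)
Definition expect_le (f : Omega -> \bar R) : Prop :=
  [/\ measurable_fun setT f, forall w, 0 <= f w & \int[P]_w f w <= c].

Lemma expect_le_limn_einf (f : nat -> Omega -> \bar R) :
  (forall n, expect_le (f n)) -> expect_le (fun w => limn_einf (f^~ w)).
Proof.
move=> H; have mf n : measurable_fun setT (f n) by have [] := H n.
have f0 n w : 0 <= f n w by have [_ + _] := H n.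
have fc n : \int[P]_w f n w <= c by have [] := H n.
split.
- rewrite /limn_einf; apply: measurableT_comp => //.
  by apply: measurable_fun_limn_esup => n; exact: measurableT_comp.
- by move=> w; apply: le_limn_einf; exists 0%N.
- apply: (le_trans (fatou _ _ _ _)) => //.
  by apply: le_trans (limn_einf_sup _) _; apply: limn_esup_le; exists 0%N.
Qed.

Lemma integral_limn_esup_le (G : nat -> set (set Omega)) Y : filtration G ->
  (forall n w, 0 <= Y n w) -> (forall n, measurable_wrt (G n) (Y n)) ->
  (forall n N s, bounded_stopping G n N s -> \int[P]_w Y (s w) w <= c) ->
  \int[P]_w limn_esup (Y^~ w) <= c.
Proof.
move=> fG Y0 GY Yc.
have [mZ Z0] : expect_le (fun w => limn_einf (fun j => limn_einf (fun k =>
    limn_einf (fun l => limn_einf (fun N =>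
      Y (hit Y (level Y j k l) N (k + l) w) w))))).
  do 4 (apply: expect_le_limn_einf => ?).
  (* The level is known at time [k + l], exactly when the wait begins. *)
  have bs := bounded_stopping_hit fG GY _ (measurable_wrt_level fG GY _ _ _).
  by split=> //; [exact: measurable_stopped (bs _ _ _ _)|exact: Yc (bs _ _ _ _)].
apply: le_trans; apply: ge0_le_integral => //.
- move=> w _; apply: le_trans (limn_einf_sup _).
  by apply: le_limn_einf; exists 0%N.
- apply: measurable_fun_limn_esup => n.
  exact: sub_sigma_measurable_fun (fG.1 n) (GY n).
- by move=> w _; exact: limn_esup_le_hit.
Qed.

End fatou_limsup.

(** * Optional stopping at bounded times, then at arbitrary ones *)

Section optional_stopping.
Context {R : realType} {d : measure_display} {Omega : measurableType d}.
Variables (P : probability Omega R) (G : nat -> set (set Omega)).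
Hypothesis fG : filtration G.

Let sG n : sub_sigma (G n) := fG.1 n.

(** Induction on the truncation [minn (s w) k]: raising [k] by one changes the value only on the
    event [k < s w], which lies in [G k], where the one-step inequality applies. *)
Lemma optional_stopping (L : nat -> Omega -> \bar R) N s :
  (forall n w, 0 <= L n w) -> (forall n, measurable_wrt (G n) (L n)) ->
  (forall n, (n < N)%N -> cond_exp_le P (G n) (L n.+1) (L n)) ->
  bounded_stopping G 0 N s ->
  \int[P]_w L (s w) w <= \int[P]_w L 0%N w.
Proof.
move=> L0 GL LS bs.
have mL n := sub_sigma_measurable_fun (sG n) (GL n).
have bsk k : bounded_stopping G 0 N (fun w => minn (s w) k).
  exact: (bounded_stopping_cap fG bs (stopping_time_cst fG (Fin k))).
have msk k := measurable_stopped fG GL (bsk k).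
suff H k : (k <= N)%N -> \int[P]_w L (minn (s w) k) w <= \int[P]_w L 0%N w.
  have := H N (leqnn N); under eq_integral => w _.
    rewrite (minn_idPl _); last by have /andP[] := bs.1 w.
    over.
  by [].
elim: k => [_|k ih kN].
  by under eq_integral do rewrite minn0.
apply: le_trans (ih (ltnW kN)).
pose A := [set w | (s w <= k)%N].
have GA : G k A := bs.2 k.
have GA' : G k (~` A) := sub_sigmaC (sG k) GA.
have mA := (sG k).2 _ GA; have mA' := (sG k).2 _ GA'.
have split f : measurable_fun setT f -> (forall w, 0 <= f w) ->
    \int[P]_w f w = \int[P]_(w in A) f w + \int[P]_(w in ~` A) f w.
  move=> mf f0; rewrite -(setUv A) ge0_integral_setU//.
    exact: measurable_funTS.
  by rewrite disj_set2E setICr.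
rewrite split// [leRHS]split//.
have -> : \int[P]_(w in A) L (minn (s w) k.+1) w =
    \int[P]_(w in A) L (minn (s w) k) w.
  apply: eq_integral => w; rewrite inE /A/= => sk.
  by rewrite (minn_idPl sk) (minn_idPl (leqW sk)).
rewrite leeD2l//.
have [Z [[GZ intZ ZE] ZL]] := LS k kN.
rewrite (eq_integral (L k.+1)); last first.
  move=> w; rewrite inE /A/= => /negP; rewrite -ltnNge => ks.
  by rewrite (minn_idPr ks).
rewrite [leRHS](eq_integral (L k)); last first.
  move=> w; rewrite inE /A/= => /negP; rewrite -ltnNge => ks.
  by rewrite (minn_idPr (ltnW ks)).
rewrite -ZE//; apply: ae_le_integral => //; first exact: integrableS intZ.
exact: measurable_funTS.
Qed.

Lemma stoppedE (X : nat -> Omega -> \bar R) tau w :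
  stopped X tau w = limn_esup (fun n => X (cap n (tau w)) w).
Proof.
rewrite /stopped; case: (tau w) => [k|] //=.
apply/eqP; rewrite eq_le; apply/andP; split.
  apply: le_trans (limn_einf_sup _); apply: le_limn_einf; exists k => n kn.
  by rewrite (minn_idPr kn).
by apply: limn_esup_le; exists k => n kn; rewrite (minn_idPr kn).
Qed.

Lemma expect_stopped_le (X : nat -> Omega -> \bar R) rho tau c :
  (forall n w, 0 <= X n w) -> (forall n, measurable_wrt (G n) (X n)) ->
  (forall N s, bounded_stopping G 0 N s -> (forall w, xle (Fin (s w)) rho) ->
    \int[P]_w X (s w) w <= c) ->
  stopping_time G tau -> P [set w | xle (tau w) rho] = 1 ->
  \int[P]_w stopped X tau w <= c.
Proof.
move=> X0 GX Xc Gtau Ptau.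
(* [tau] is below [rho] only almost surely, whereas the hypothesis concerns times below [rho]
   everywhere. The second cap enforces this and changes the integrand only on a null set. *)
pose cap2 n w := cap (cap n (tau w)) rho.
have bs2 N s : bounded_stopping G 0 N s ->
    bounded_stopping G 0 N (fun w => cap2 (s w) w).
  move=> bs; apply: (bounded_stopping_cap fG _ (stopping_time_cst fG rho)).
  exact: bounded_stopping_cap.
have cst0 n : bounded_stopping G 0 n (fun=> n).
  by apply: bounded_stopping_le (bounded_stopping_cst fG n).
have GY n : measurable_wrt (G n) (fun w => X (cap2 n w) w).
  exact: (measurable_wrt_stopped fG GX (bs2 _ _ (cst0 n))).
have mtau : measurable [set w | xle (tau w) rho].
  case: rho {Xc Ptau cap2 bs2 GY} => [k|]; first exact: (sG k).2.
  rewrite (_ : [set _ | _] = setT)//; apply/seteqP; split=> // w _ /=.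
  by case: (tau w).
have ae_tau : {ae P, forall w, xle (tau w) rho}.
  exists (~` [set w | xle (tau w) rho]); split => //; first exact: measurableC.
  by rewrite probability_setC// Ptau subee.
have -> : \int[P]_w stopped X tau w =
    \int[P]_w limn_esup (fun n => X (cap2 n w) w).
  under eq_integral do rewrite stoppedE.
  apply: ae_eq_integral => //.
  - apply: measurable_fun_limn_esup => n.
    exact: (measurable_stopped fG GX (bounded_stopping_cap fG (cst0 n) Gtau)).
  - apply: measurable_fun_limn_esup => n.
    exact: (sub_sigma_measurable_fun (sG n) (GY n)).
  - apply: filterS ae_tau => w tr _; congr limn_esup; apply/funext => n.
    congr (X _ w); rewrite /cap2.
    case: rho tr {Xc Ptau cap2 bs2 GY mtau} => //= k.
    case: (tau w) => //= i ik; apply/esym/minn_idPl.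
    by rewrite (leq_trans _ ik)// geq_minr.
apply: (integral_limn_esup_le fG) => // n N s bs; apply: Xc; last first.
  by move=> w; exact: xle_cap.
exact/bs2/(bounded_stopping_le _ _ bs).
Qed.

End optional_stopping.

(** * Worst-case stopping values and the two main implications *)

Section worst_case.
Context {R : realType} {d : measure_display} {Omega : measurableType d}.
Variables (PP : set (probability Omega R)) (F : nat -> nat -> set (set Omega)).
Variables (E : nat -> nat -> Omega -> \bar R) (r : nat -> xnat).
Hypothesis fF : filtration_seq F.

Definition worst_case (m : nat) : \bar R :=
  ereal_sup [set x | exists P N s, [/\ PP P, bounded_stopping (F m) 0 N s,
    forall w, xle (Fin (s w)) (r m) & x = \int[P]_w E m (s w) w]].

Lemma le_worst_case m P N s : PP P -> bounded_stopping (F m) 0 N s ->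
  (forall w, xle (Fin (s w)) (r m)) -> \int[P]_w E m (s w) w <= worst_case m.
Proof. by move=> PPP bs sr; apply: ereal_sup_ubound; exists P, N, s. Qed.

Lemma stop_Tfin_bounded m N s : bounded_stopping (F m) 0 N s ->
  (forall w, xle (Fin (s w)) (r m)) -> stop_Tfin (r m) (F m) PP (Fin \o s).
Proof.
move=> [_ Gs] sr; split=> //; split=> // P PPP.
rewrite -(probability_setT P); congr (P _).
by apply/seteqP; split=> // w _; exact: sr.
Qed.

(** If the limit superior exceeded a real [a > 1], near-optimal times at the indices where the worst
    case exceeds [a] would form one sequence violating the hypothesis. *)
Lemma limn_esup_worst_case :
  (forall tau, stop_seq_Tfin r F PP tau ->
      limsup_sup_expect PP (fun m _ => stopped (E m) (tau m)) <= 1) ->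
  limn_esup worst_case <= 1.
Proof.
move=> H; rewrite leNgt; apply/negP => /ereal_dense[a [a1 aw]].
have /choice[tau tauP] m : exists t : Omega -> xnat,
    stop_Tfin (r m) (F m) PP t /\ (a%:E < worst_case m ->
      a%:E <= ereal_sup [set expect P (stopped (E m) t) | P in PP]).
  have [am|ma] := ltP a%:E (worst_case m); last first.
    (* At the remaining indices any admissible time will do. *)
    exists (Fin \o fun=> 0%N); split=> //.
    apply: (stop_Tfin_bounded (bounded_stopping_cst (fF m) 0)) => w.
    by case: (r m).
  have [_ [P [N [s [PPP bs sr ->]]]] as_] := ereal_sup_gt am.
  exists (Fin \o s); split=> [|_]; first exact: stop_Tfin_bounded bs sr.
  by rewrite ltW// (lt_le_trans as_)//; apply: ereal_sup_ubound; exists P.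
have := le_lt_trans (H tau (fun m => (tauP m).1)) a1.
move=> /limn_esup_lt[k kP]; have [n kn an] := lt_limn_esup aw k.
by have := (tauP n).2 an; rewrite leNgt kP.
Qed.

Definition supermartingale_domination : Prop :=
   exists (L : probability Omega R -> nat -> nat -> Omega -> \bar R) (m0 : nat),
     (forall P, PP P -> forall m n w, 0 <= L P m n w) /\
     (forall P, PP P -> forall m n, measurable_wrt (F m n) (L P m n)) /\
     (forall P, PP P -> forall m n, {ae P, forall w, E m n w <= L P m n w}) /\
     (forall m, (m0 <= m)%N -> forall P, PP P -> forall n, xle (Fin n) (r m) ->
        P.-integrable setT (L P m n)) /\
     (forall m, (m0 <= m)%N -> forall P, PP P -> forall n, xle (Fin n.+1) (r m) ->
        cond_exp_le P (F m n) (L P m n.+1) (L P m n)) /\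
     limsup_sup_expect PP (fun m P => L P m 0%N) <= 1.

Hypothesis E0 : nonneg_process E.
Hypothesis FE : adapted F E.

Lemma supermartingale_domination_eprocess :
  supermartingale_domination -> asymptotic_eprocess PP F r E.
Proof.
move=> [L [m0 [L0 [GL [EL [_ [LS LE]]]]]]].
split; [exact: E0|split; [exact: FE|move=> tau tauT]].
apply: le_trans LE; apply: limn_esup_le_near; exists m0 => m m0m.
apply/ereal_supP => _ [P PPP <-]; apply: (@le_trans _ _ (expect P (L P m 0%N))).
  have [Gtau Ptau] := tauT m.
  apply: (expect_stopped_le (fF m) _ _ _ Gtau (Ptau P PPP)) => //.
  move=> N s bs sr.
  apply: (@le_trans _ _ (\int[P]_w L P m (s w) w)).
    apply: ae_ge0_le_integral => //.
    - exact: (measurable_stopped (fF m) (FE m) bs).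
    - by move=> w _; exact: L0.
    - exact: (measurable_stopped (fF m) (GL P PPP m) bs).
    (* Countably many null sets are merged, so the domination holds at the random index [s w]. *)
    - by apply: filterS (ae_foralln (EL P PPP m)) => w /(_ (s w)).
  (* The horizon is cut at [r m] because the supermartingale inequality is given only for steps
     ending by then. *)
  apply: (@optional_stopping _ _ _ _ _ (fF m) _ (cap N (r m))) => //.
  - exact: L0.
  - exact: GL.
  - move=> n nN; apply: LS => //; move: (xle_cap N (r m)).
    by case: (r m) nN => //= k; exact: leq_trans.
  - split=> [w|]; last exact: bs.2.
    have /andP[_ sN] := bs.1 w; have := sr w.
    by case: (r m) => [k|] //= sk; rewrite leq_min sN.
by apply: ereal_sup_ubound; exists P.
Qed.

Lemma ex_supermartingale_domination :
  (forall tau, stop_seq_Tfin r F PP tau ->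
      limsup_sup_expect PP (fun m _ => stopped (E m) (tau m)) <= 1) ->
  supermartingale_domination.
Proof.
move=> /limn_esup_worst_case wc1.
have [m0 m0P] := limn_esup_lt (le_lt_trans wc1 (ltry 1)).
have /choice[K KP] (Pm : probability Omega R * nat) :
    exists K : nat -> Omega -> \bar R, PP Pm.1 -> (m0 <= Pm.2)%N ->
    [/\ forall n w, E Pm.2 (cap n (r Pm.2)) w <= K n w,
      forall n, measurable_wrt (F Pm.2 n) (K n),
      forall n, Pm.1.-integrable setT (K n),
      forall n, cond_exp_le Pm.1 (F Pm.2 n) (K n.+1) (K n) &
      \int[Pm.1]_w K 0%N w <= worst_case Pm.2].
  case: Pm => P m /=.
  have [PPP|nPPP] := pselect (PP P); last by exists (fun=> cst 0).
  have [m0m|mm0] := leqP m0 m; last by exists (fun=> cst 0).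
  have bcap N s : bounded_stopping (F m) 0 N s ->
      bounded_stopping (F m) 0 N (fun w => cap (s w) (r m)).
    move=> bs.
    exact: (bounded_stopping_cap (fF m) bs (stopping_time_cst (fF m) _)).
  have [|||K KP] := @ex_snell_envelope _ _ _ P _ (fF m)
    (fun n w => E m (cap n (r m)) w) _ _ _ (m0P m m0m).
  - by move=> *; exact: E0.
  - move=> n B mB; apply: (filtration_le (fF m) (cap_le n (r m))); exact: FE.
  - move=> n N s bs.
    apply: (le_worst_case PPP (bcap _ _ (bounded_stopping_le _ _ bs))) => //.
    by move=> w; exact: xle_cap.
  by exists K.
exists (fun P m n w =>
  if (m0 <= m)%N then maxe (E m n w) (K (P, m) n w) else E m n w).
have capE m n : xle (Fin n) (r m) -> cap n (r m) = n.
  by case: (r m) => //= k nk; exact/minn_idPl.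
have KE P m n : PP P -> (m0 <= m)%N -> xle (Fin n) (r m) ->
    (fun w => if (m0 <= m)%N then maxe (E m n w) (K (P, m) n w) else E m n w)
    = K (P, m) n.
  move=> PPP m0m nr; rewrite m0m; apply/funext => w; apply/max_idPr.
  by have [+ _ _ _ _] := KP (P, m) PPP m0m; move=> /(_ n w)/=; rewrite capE.
exists m0; split; first by move=> P _ m n w; case: ifP; rewrite ?le_max E0.
split.
  move=> P PPP m n; have [m0m|_] := leqP m0 m; last exact: FE.
  have [_ + _ _ _] := KP (P, m) PPP m0m; move=> /(_ n)/= GK.
  have [sG _] := (fF m).1 n.
  by apply/measurable_wrtP => //; apply: measurable_maxe; apply/measurable_wrtP.
split.
  move=> P PPP m n; apply: aeW => w; case: ifP => // _.
  by rewrite le_max lexx.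
split.
  move=> m m0m P PPP n nr; rewrite KE//.
  by have [_ _ + _ _] := KP (P, m) PPP m0m; exact.
split.
  move=> m m0m P PPP n nr; rewrite !KE//; last first.
    by move: nr; case: (r m) => //= k; exact: ltnW.
  by have [_ _ _ + _] := KP (P, m) PPP m0m; exact.
apply: le_trans wc1; apply: limn_esup_le_near; exists m0 => m m0m.
apply/ereal_supP => _ [P PPP <-]; rewrite KE//; last by case: (r m).
by have [_ _ _ _] := KP (P, m) PPP m0m.
Qed.

End worst_case.

Theorem mainTheorem4 (R : realType) (d : measure_display) (Omega : measurableType d)
  (PP : set (probability Omega R))
  (F : nat -> nat -> set (set Omega))
  (E : nat -> nat -> Omega -> \bar R)
  (r : nat -> xnat) :
  filtration_seq F -> nonneg_process E -> adapted F E ->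
  (asymptotic_eprocess PP F r E <->
   (forall tau, stop_seq_Tfin r F PP tau ->
      limsup_sup_expect PP (fun m _ => stopped (E m) (tau m)) <= 1))
  /\
  (asymptotic_eprocess PP F r E <->
   exists (L : probability Omega R -> nat -> nat -> Omega -> \bar R) (m0 : nat),
     (forall P, PP P -> forall m n w, 0 <= L P m n w) /\
     (forall P, PP P -> forall m n, measurable_wrt (F m n) (L P m n)) /\
     (forall P, PP P -> forall m n, {ae P, forall w, E m n w <= L P m n w}) /\
     (forall m, (m0 <= m)%N -> forall P, PP P -> forall n, xle (Fin n) (r m) ->
        P.-integrable setT (L P m n)) /\
     (forall m, (m0 <= m)%N -> forall P, PP P -> forall n, xle (Fin n.+1) (r m) ->
        cond_exp_le P (F m n) (L P m n.+1) (L P m n)) /\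
     limsup_sup_expect PP (fun m P => L P m 0%N) <= 1).
Proof.
move=> fF E0 FE.
have i_ii : asymptotic_eprocess PP F r E ->
    forall tau, stop_seq_Tfin r F PP tau ->
    limsup_sup_expect PP (fun m _ => stopped (E m) (tau m)) <= 1.
  by move=> [_ [_ H]] tau tauT; apply: H => m; exact: (tauT m).1.
have ii_iii := ex_supermartingale_domination fF E0 FE.
have iii_i := supermartingale_domination_eprocess fF E0 FE.
split; split.
- exact: i_ii.
- by move=> /ii_iii; exact: iii_i.
- by move=> /i_ii; exact: ii_iii.
- exact: iii_i.
Qed.
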